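(* There exist two marked flat tori $[S,f],[S',f']\in\mathcal{T}_1$ (each with its area-$1$ flat metric) and infinitely many distinct homeomorphisms $\varphi:S\to S'$ respecting the markings (i.e. homotopic to $f'^{-1}\circ f$), each of which realizes the extremal Lipschitz constant, that is, $\mathcal{L}(\varphi)=\inf_{\varphi'}\mathcal{L}(\varphi')$, where the infimum is over all Lipschitz maps $\varphi':S\to S'$ homotopic to $f'^{-1}\circ f$.
   Context: Teichmüller space of the torus: fix the oriented torus $S_1=\mathbb{C}/(\mathbb{Z}+i\mathbb{Z})$. $\mathcal{T}_1$ is the set of pairs $(S,f)$, with $S$ a closed Riemann surface of genus $1$ and $f:S\to S_1$ an orientation-preserving homeomorphism (the marking), modulo the relation $(S,f)\sim(S',f')$ iff there is a conformal homeomorphism $k:S\to S'$ with $f'\circ k$ homotopic to $f$. Every such $S$ is conformally equivalent to some $\mathbb{C}/\Lambda$ of area $1$, $\Lambda\subset\mathbb{C}$ a lattice, and is given the flat metric induced from $\mathbb{C}$. Lipschitz constant: for a homeomorphism $\varphi:S\to S'$, with $d_S,d_{S'}$ the distances of the flat metrics, $\mathcal{L}(\varphi)=\sup_{x\neq y}\frac{d_{S'}(\varphi(x),\varphi(y))}{d_S(x,y)}$; when this is finite $\varphi$ is called a Lipschitz map. *)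

(* Defs.v *)
From HB Require Import structures.
From mathcomp Require Import all_boot all_order all_algebra.
From mathcomp Require Import generic_quotient.
From mathcomp Require Import complex.
From mathcomp Require Import all_classical all_reals all_analysis.

Set Implicit Arguments.
Unset Strict Implicit.
Unset Printing Implicit Defensive.

Import Order.TTheory GRing.Theory Num.Theory.
Import numFieldNormedType.Exports.

Local Open Scope classical_set_scope.
Local Open Scope quotient_scope.
Local Open Scope complex_scope.
Local Open Scope ring_scope.

Section Tori.
Variable R : realType.
(* [R[i]^o] is [R[i]] seen as a normed space over itself: its topology is the
   usual one and [derivable] on it means complex differentiability. *)
Local Notation C := (R[i]^o).

(* The modulus as an element of [R]; the library's [`|z|] lies in [R[i]]. *)
Definition modulus (z : C) : R := complex.Re `|z|.

Definition cross (u v : C) : R :=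
  complex.Re u * complex.Im v - complex.Im u * complex.Re v.

Definition zspan (w1 w2 : C) : set C :=
  [set z | exists m n : int, z = w1 *~ m + w2 *~ n].

(* Lattices of covolume 1: the parallelogram spanned by a basis has area 1. *)
Record lattice := Lattice {
  lattice_set : set C;
  lattice_area1 :
    exists w1 w2 : C, `|cross w1 w2| = 1 /\ lattice_set = zspan w1 w2 }.

Lemma lattice0 (L : lattice) : lattice_set L 0.
Proof.
by have [w1 [w2 [_ ->]]] := lattice_area1 L; exists 0, 0; rewrite !mulr0z addr0.
Qed.

Lemma latticeB (L : lattice) (z w : C) : lattice_set L z -> lattice_set L w -> lattice_set L (z - w).
Proof.
have [w1 [w2 [_ ->]]] := lattice_area1 L => -[m [n ->]] [m' [n' ->]].
by exists (m - m'), (n - n'); rewrite !mulrzBr opprD addrACA.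
Qed.

Lemma latticeN (L : lattice) (z : C) : lattice_set L z -> lattice_set L (- z).
Proof. by move=> Lz; rewrite -sub0r; apply: latticeB => //; exact: lattice0. Qed.

Lemma latticeD (L : lattice) (z w : C) : lattice_set L z -> lattice_set L w -> lattice_set L (z + w).
Proof. by move=> Lz Lw; rewrite -(opprK w); apply: latticeB => //; exact: latticeN. Qed.

Definition lattice_rel (L : lattice) : rel C := fun z w => `[< lattice_set L (z - w) >].

Lemma lattice_rel_refl (L : lattice) : reflexive (lattice_rel L).
Proof. by move=> z; apply/asboolP; rewrite subrr; exact: lattice0. Qed.

Lemma lattice_rel_sym (L : lattice) : symmetric (lattice_rel L).
Proof.
by move=> z w; apply/asboolP/asboolP => /latticeN; rewrite opprB.
Qed.

Lemma lattice_rel_trans (L : lattice) : transitive (lattice_rel L).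
Proof.
move=> w z t /asboolP zw /asboolP wt; apply/asboolP.
by have := latticeD zw wt; rewrite addrA subrK.
Qed.

Canonical lattice_equiv (L : lattice) : equiv_rel C :=
  EquivRel (lattice_rel L)
    (@lattice_rel_refl L) (@lattice_rel_sym L) (@lattice_rel_trans L).

Definition torus (L : lattice) : topologicalType :=
  quotient_topology {eq_quot (lattice_equiv L)}.

Definition torus_pi (L : lattice) (z : C) : torus L :=
  (\pi_({eq_quot (lattice_equiv L)}) z)%qT.

Lemma torus_piP (L : lattice) (z w : C) : torus_pi L z = torus_pi L w <-> lattice_set L (z - w).
Proof.
split=> [/eqmodP/asboolP //|Lzw].
by apply/eqmodP/asboolP.
Qed.

(* The quotient metric, which is the distance of the flat metric on C / L. *)
Definition flat_dist (L : lattice) (x y : torus L) : R :=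
  inf [set d | exists z w : C,
    [/\ torus_pi L z = x, torus_pi L w = y & d = modulus (z - w)]].

Definition Lip (L L' : lattice) (phi : torus L -> torus L') : \bar R :=
  ereal_sup [set q | exists x y : torus L, x <> y /\
    q = (flat_dist (phi x) (phi y) / flat_dist x y)%:E].

Definition homeomorphism (X Y : topologicalType) (f : X -> Y) : Prop :=
  exists g : Y -> X, [/\ continuous f, continuous g, cancel f g & cancel g f].

Definition homotopic (X Y : topologicalType) (f g : X -> Y) : Prop :=
  exists H : R * X -> Y,
    {within `[0%R, 1%R]%classic `*` [set: X], continuous H} /\
    forall x, H (0, x) = f x /\ H (1, x) = g x.

(* [g] expresses [k] near [z] in the charts given by local inverses of the
   projections. *)
Definition local_expr (L L' : lattice) (k : torus L -> torus L')
    (z : C) (g : C -> C) : Prop :=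
  \forall w \near z, torus_pi L' (g w) = k (torus_pi L w).

Definition holomorphic (L L' : lattice) (k : torus L -> torus L') : Prop :=
  forall z : C, exists g : C -> C,
    local_expr k z g /\ \forall w \near z, derivable g w 1.

(* The inverse of a holomorphic homeomorphism is again holomorphic. *)
Definition conformal_homeo (L L' : lattice) (k : torus L -> torus L') : Prop :=
  homeomorphism k /\ holomorphic k.

Definition expi (t : R) : C := (cos t +i* sin t).

(* The path [gamma] on [0, 1] avoids 0 and has a continuous argument [theta]
   along which it turns [n] times around 0. *)
Definition winds (gamma : R -> C) (n : int) : Prop :=
  exists theta : R -> R,
    [/\ {within `[0%R, 1%R]%classic, continuous theta},
        forall t, 0 <= t <= 1 ->
          gamma t != 0 /\ gamma t = (modulus (gamma t))%:C * expi (theta t)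
      & theta 1 - theta 0 = (2 * pi) *~ n].

(* Local degree +1 at every point: in charts, the image of every small
   positively oriented circle around [z] winds once around the image of [z]. *)
Definition orientation_preserving (L L' : lattice)
    (k : torus L -> torus L') : Prop :=
  forall z : C, exists g : C -> C,
    [/\ local_expr k z g,
        \forall w \near z, {for w, continuous g}
      & \forall r \near (0 : R)^'+,
          winds (fun t => g (z + r%:C * expi (2 * pi * t)) - g z) 1].

Lemma square_area1 :
  exists w1 w2 : C, `|cross w1 w2| = 1 /\ zspan 1 (0 +i* 1) = zspan w1 w2.
Proof. by exists 1, (0 +i* 1); rewrite /cross /= mulr1 mulr0 subr0 normr1. Qed.

Definition square_lattice : lattice := Lattice square_area1.

(* Representatives [(S, f)] of the points of the Teichmüller space of the
   torus, normalized as flat tori of area 1. *)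
Record marked_torus := MarkedTorus {
  mt_lattice : lattice;
  marking : torus mt_lattice -> torus square_lattice;
  marking_inv : torus square_lattice -> torus mt_lattice;
  marking_continuous : continuous marking;
  marking_inv_continuous : continuous marking_inv;
  markingK : cancel marking marking_inv;
  marking_invK : cancel marking_inv marking;
  marking_oriented : orientation_preserving marking }.

Arguments marking : clear implicits.
Arguments marking_inv : clear implicits.

Definition teich_equiv (T T' : marked_torus) : Prop :=
  exists k : torus (mt_lattice T) -> torus (mt_lattice T'),
    conformal_homeo k /\ homotopic (marking T' \o k) (marking T).

Definition respects_markings (T T' : marked_torus)
    (phi : torus (mt_lattice T) -> torus (mt_lattice T')) : Prop :=
  homotopic phi (marking_inv T' \o marking T).

Definition lipschitz_map (L L' : lattice) (phi : torus L -> torus L') : Prop :=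
  homeomorphism phi /\ (Lip phi < +oo)%E.

Definition extremal_Lip (T T' : marked_torus) : \bar R :=
  ereal_inf [set Lip phi | phi in
    [set phi : torus (mt_lattice T) -> torus (mt_lattice T') |
      lipschitz_map phi /\ respects_markings phi]].

End Tori.

Arguments marking {R} _ _.
Arguments marking_inv {R} _ _.

(* Main.v *)
Require Import Defs.
From mathcomp Require Import all_boot all_order all_algebra.
From mathcomp Require Import generic_quotient.
From mathcomp Require Import complex.
From mathcomp Require Import all_classical all_reals all_analysis.
From mathcomp Require Import ring lra.

(** Take the square torus with the identity marking and the torus with sides 2
    and 1/2, marked by the linear map that matches the sides. Then
    [marking_inv T' \o marking T] is the stretch (x, y) |-> (2x, y/2).

    The extremal Lipschitz constant is 2. The stretch followed by any translation
    of the target is a homeomorphism homotopic to the stretch, and it is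
    2-Lipschitz ([Lip_extremal_map_le]). Conversely, a map respecting the markings
    lifts to a map F of the plane with F(z + 1) = F(z) + 2 and
    F(z + i) = F(z) + i/2 ([respects_markings_lift]). The image of a horizontal
    side of length 1 under F has its endpoints at distance 2. As the flat distance
    between nearby points is the distance of nearby lifts, the Lipschitz constant
    is at least 2 ([Lip_ge2]). Translations by distinct small vectors then give
    infinitely many extremal maps.

    Lifting needs no covering theory: by compactness of the torus, two maps at
    nearby times of a homotopy are uniformly close, and a map uniformly close to
    one that has a lift is lifted by choosing the nearest point in each fibre
    ([lift_close], [homotopic_lift]). The periods of the lift do not change.

    The two marked tori are distinct in Teichmüller space ([not_teich_equiv]): a
    conformal map respecting the markings would have an entire lift F with the
    periods above. By Cauchy's theorem ([boundary_unit_square], by Goursat's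
    bisection argument) the integral of F along the boundary of the unit square
    vanishes, while the periods show that it equals 2i - i/2. *)

Set Implicit Arguments.
Unset Strict Implicit.
Unset Printing Implicit Defensive.

Import Order.TTheory GRing.Theory Num.Theory.
Import numFieldNormedType.Exports.

Local Open Scope classical_set_scope.
Local Open Scope complex_scope.
Local Open Scope ring_scope.

(** * The modulus and the topology of the complex plane *)

Section Plane.
Variable R : realType.
Local Notation C := (R[i]^o).
Local Notation Re := complex.Re.
Local Notation Im := complex.Im.
Implicit Types (z w : C) (r e : R).

Lemma cReB z w : Re (z - w) = Re z - Re w. Proof. by case: z; case: w. Qed.
Lemma cImB z w : Im (z - w) = Im z - Im w. Proof. by case: z; case: w. Qed.
Lemma cReD z w : Re (z + w) = Re z + Re w. Proof. by case: z; case: w. Qed.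
Lemma cImD z w : Im (z + w) = Im z + Im w. Proof. by case: z; case: w. Qed.

Lemma cReM z w : Re (z * w) = Re z * Re w - Im z * Im w.
Proof. by case: z; case: w. Qed.
Lemma cImM z w : Im (z * w) = Re z * Im w + Im z * Re w.
Proof. by case: z; case: w. Qed.

Lemma complex_ext z w : Re z = Re w -> Im z = Im w -> z = w.
Proof. by case: z => ? ?; case: w => ? ? /= -> ->. Qed.

Lemma modulusE z : modulus z = Num.sqrt (Re z ^+ 2 + Im z ^+ 2).
Proof. by rewrite /modulus (normc_def (z : R[i])). Qed.

Lemma norm_modulus z : `|z| = (modulus z)%:C.
Proof. by rewrite modulusE -(normc_def (z : R[i])). Qed.

Lemma modulus_ge0 z : 0 <= modulus z.
Proof. by rewrite modulusE sqrtr_ge0. Qed.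

Lemma modulusD z w : modulus (z + w) <= modulus z + modulus w.
Proof.
have : `|z + w| <= `|z| + `|w| := ler_normD z w.
by rewrite !norm_modulus -rmorphD /= lecR.
Qed.

Lemma modulusN z : modulus (- z) = modulus z.
Proof. by rewrite /modulus normrN. Qed.

Lemma modulusBC z w : modulus (z - w) = modulus (w - z).
Proof. by rewrite -modulusN opprB. Qed.

Lemma modulusM z w : modulus (z * w) = modulus z * modulus w.
Proof.
have : `|(z : R[i]) * w| = `|(z : R[i])| * `|(w : R[i])| := normrM _ _.
by rewrite !norm_modulus -rmorphM => -[].
Qed.

Lemma modulus0 : modulus (0 : C) = 0.
Proof. by rewrite /modulus normr0. Qed.

Lemma modulus_real r : modulus (r%:C : C) = `|r|.
Proof. by rewrite modulusE /= expr0n /= addr0 sqrtr_sqr. Qed.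

Lemma modulus_eq0 z : (modulus z == 0) = (z == 0).
Proof.
apply/eqP/eqP => [z0|->]; last exact: modulus0.
by apply/eqP; rewrite -normr_eq0 norm_modulus z0.
Qed.

Lemma modulus_triangle v z w :
  modulus (z - w) <= modulus (z - v) + modulus (v - w).
Proof. by rewrite -[in leLHS](subrK v z) -addrA modulusD. Qed.

Lemma Re_modulus z : `|Re z| <= modulus z.
Proof.
by rewrite modulusE -[leLHS]sqrtr_sqr; apply: ler_wsqrtr; rewrite lerDl sqr_ge0.
Qed.

Lemma Im_modulus z : `|Im z| <= modulus z.
Proof.
by rewrite modulusE -[leLHS]sqrtr_sqr; apply: ler_wsqrtr; rewrite lerDr sqr_ge0.
Qed.

Lemma modulus_le z : modulus z <= `|Re z| + `|Im z|.
Proof.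
rewrite modulusE -[leRHS]ger0_norm ?addr_ge0// -sqrtr_sqr.
apply: ler_wsqrtr; rewrite sqrrD !real_normK ?num_real// addrAC lerDl.
by rewrite mulrn_wge0 // mulr_ge0.
Qed.

Lemma nbhs_modulusP z (P : set C) :
  nbhs z P <-> exists2 e, 0 < e & forall w, modulus (w - z) < e -> P w.
Proof.
rewrite nbhs_ballP; split=> [[[e e']]|[e e0 eP]].
  rewrite /= ltcE /= => /andP[/eqP e'0 e0] sub; exists e => // w we.
  by apply: sub; rewrite /ball/= norm_modulus modulusBC ltcE /= e'0 eqxx.
exists e%:C; first by rewrite /= ltcE /= eqxx.
by move=> w; rewrite /ball/= norm_modulus modulusBC ltcR; exact: eP.
Qed.

Lemma continuous_modulusP (F : C -> C) z :
  {for z, continuous F} <->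
  forall e, 0 < e -> exists2 d, 0 < d &
    forall w, modulus (w - z) < d -> modulus (F w - F z) < e.
Proof.
split=> [cF e e0|cF P /nbhs_modulusP[e e0 eP]].
  have /cF/nbhs_modulusP[d d0 dP] : nbhs (F z) [set w | modulus (w - F z) < e].
    by apply/nbhs_modulusP; exists e.
  by exists d.
apply/nbhs_modulusP; have [d d0 dP] := cF _ e0.
by exists d => // w /dP/eP.
Qed.

Lemma modulus_ReIm_lt z e : `|Re z| < e / 2 -> `|Im z| < e / 2 -> modulus z < e.
Proof. by move=> ? ?; have := modulus_le z; lra. Qed.

End Plane.

(** * The topology of a torus and the maps it inherits from the plane *)

Section Torus.
Variable R : realType.
Local Notation C := (R[i]^o).
Local Notation Re := complex.Re.
Local Notation Im := complex.Im.
Implicit Types (z w : C) (r e t : R) (L : lattice R).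

Lemma torus_pi_surj L (x : torus L) : exists z, x = torus_pi L z.
Proof. by exists (repr (x : {eq_quot (lattice_equiv L)})%qT); rewrite /torus_pi reprK. Qed.

(** The projection onto a torus is continuous and open. *)
Lemma nbhs_torusP L z (P : set (torus L)) :
  nbhs (torus_pi L z) P <-> \forall w \near z, P (torus_pi L w).
Proof.
split=> [|zP].
  exact: (@pi_continuous _ {eq_quot (lattice_equiv L)}%qT z).
pose U : set C := [set w | \forall w' \near w, P (torus_pi L w')].
have UL w l : lattice_set L l -> U w -> U (w + l).
  move=> Ll /nbhs_modulusP[e e0 eP]; apply/nbhs_modulusP; exists e => // w' we.
  have -> : torus_pi L w' = torus_pi L (w' - l).
    by apply/torus_piP; rewrite opprB addrCA subrr addr0.
  by apply: eP; rewrite addrAC -addrA -opprD.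
rewrite nbhsE /=; exists (torus_pi L @` U); last first.
  by move=> _ [w /nbhs_singleton + <-].
split; last by exists z.
rewrite /open /= /quotient_open.
have -> : \pi_(quotient_topology {eq_quot (lattice_equiv L)})%qT @^-1`
    (torus_pi L @` U) = U.
  apply/seteqP; split=> w /=; last by move=> Uw; exists w.
  by move=> [w' Uw'] /torus_piP/latticeN/UL/(_ Uw'); rewrite opprB addrC subrK.
rewrite openE /U => w /= /nbhs_modulusP[e e0 eP].
apply/nbhs_modulusP; exists (e / 2); first by rewrite divr_gt0.
move=> w' w'e; apply/nbhs_modulusP; exists (e / 2); first by rewrite divr_gt0.
by move=> v ve; apply: eP; have := modulus_triangle w' v w; lra.
Qed.

Lemma torus_pi_continuous L : continuous (torus_pi L).
Proof. by move=> z P /nbhs_torusP. Qed.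

(** A map of the plane seen as a map between tori, by means of
    representatives; it is meaningful when the map descends to the quotients. *)
Definition torus_map L L' (F : C -> C) (x : torus L) : torus L' :=
  torus_pi L' (F (repr (x : {eq_quot (lattice_equiv L)})%qT)).

(** [F] sends points equal modulo [L] to points equal modulo [L']. *)
Definition descends L L' (F : C -> C) :=
  forall z w, lattice_set L (z - w) -> lattice_set L' (F z - F w).

Lemma torus_mapE L L' (F : C -> C) z : descends L L' F ->
  torus_map L' F (torus_pi L z) = torus_pi L' (F z).
Proof.
by move=> dF; apply/torus_piP/dF/torus_piP; rewrite /torus_pi reprK.
Qed.

Lemma torus_map_continuous L L' (F : C -> C) :
  descends L L' F -> continuous F -> continuous (torus_map L' F : torus L -> _).
Proof.
move=> dF cF x; have [z ->] := torus_pi_surj x => P.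
rewrite torus_mapE// => /nbhs_torusP /cF FP; apply/nbhs_torusP.
have {FP} : \forall w \near z, P (torus_pi L' (F w)) by exact: FP.
by apply: filterS => w; rewrite /= torus_mapE.
Qed.

(** The product of [R] with a torus also has the quotient topology. *)
Lemma torus_homotopy_continuous L (X : topologicalType) (H : R * torus L -> X) :
  continuous (fun p : R * C => H (p.1, torus_pi L p.2)) -> continuous H.
Proof.
move=> cH [t x]; have [z ->] := torus_pi_surj x => P /(cH (t, z)) [[A B]] /=.
move=> [tA zB] AB; exists (A, [set torus_pi L w | w in B]) => /=.
  split=> //; apply/nbhs_torusP; apply: filterS zB => w Bw; by exists w.
by move=> [s _] /= [As [w Bw <-]]; exact: (AB (s, w)).
Qed.

Lemma torus_map_homeomorphism L L' (F G : C -> C) :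
    descends L L' F -> descends L' L G -> continuous F -> continuous G ->
    cancel F G -> cancel G F ->
  homeomorphism (torus_map L' F : torus L -> torus L').
Proof.
move=> dF dG cF cG FK GK; exists (torus_map L G).
split=> [||x|x]; [exact: torus_map_continuous..| |];
  by have [z ->] := torus_pi_surj x; rewrite !torus_mapE// ?FK ?GK.
Qed.

(** [L] has no nonzero vector of length less than [m], for a positive [m]. *)
Definition lattice_gap L (m : R) :=
  0 < m /\ forall l, lattice_set L l -> modulus l < m -> l = 0.

Lemma gap_inj L m z w : lattice_gap L m -> modulus (z - w) < m ->
  torus_pi L z = torus_pi L w -> z = w.
Proof.
by move=> [_ gap] zw /torus_piP/gap /(_ zw) /eqP; rewrite subr_eq0 => /eqP.
Qed.

(** The distances between lifts of two points; the flat distance is their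
    infimum. *)
Definition lift_dists L (x y : torus L) : set R :=
  [set d | exists z w, [/\ torus_pi L z = x, torus_pi L w = y & d = modulus (z - w)]].

Lemma lift_dists_neq0 L (x y : torus L) : lift_dists x y !=set0.
Proof.
have [z ->] := torus_pi_surj x; have [w ->] := torus_pi_surj y.
by exists (modulus (z - w)), z, w.
Qed.

Lemma lift_dists_ge0 L (x y : torus L) : lbound (lift_dists x y) 0.
Proof. by move=> _ [z [w [_ _ ->]]]; exact: modulus_ge0. Qed.

Lemma flat_dist_ge0 L (x y : torus L) : 0 <= flat_dist x y.
Proof. by apply: lb_le_inf; [exact: lift_dists_neq0|exact: lift_dists_ge0]. Qed.

Lemma flat_dist_le L z w :
  flat_dist (torus_pi L z) (torus_pi L w) <= modulus (z - w).
Proof.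
by apply: ge_inf; [exists 0; exact: lift_dists_ge0|exists z, w].
Qed.

(** Between close points, the shortest lifted segment is the obvious one. *)
Lemma flat_dist_close L m z w : lattice_gap L m -> modulus (z - w) < m / 2 ->
  flat_dist (torus_pi L z) (torus_pi L w) = modulus (z - w).
Proof.
move=> [m0 gap] zw; apply/eqP; rewrite eq_le flat_dist_le /=.
apply: lb_le_inf; first exact: lift_dists_neq0.
move=> _ [z' [w' [/torus_piP zz' /torus_piP ww' ->]]].
rewrite leNgt; apply/negP => lt; suff E : z' - w' = z - w by rewrite E ltxx in lt.
apply/eqP; rewrite -subr_eq0; apply/eqP/gap.
  have -> : z' - w' - (z - w) = (z' - z) - (w' - w) by ring.
  exact: latticeB.
by have := modulusD (z' - w') (- (z - w)); rewrite modulusN; lra.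
Qed.

End Torus.

(** * Lifting homotopies to the plane *)

Section Lifting.
Variable R : realType.
Local Notation C := (R[i]^o).
Implicit Types (z w l : C) (r e t s m : R) (L : lattice R).

(** Induction along the unit interval: a property that passes from left to
    right between any point and its neighbours spreads from 0 to 1. *)
Lemma unit_interval_ind (P : R -> Prop) : P 0 ->
    (forall t, 0 <= t <= 1 -> exists2 e, 0 < e &
       forall s, 0 <= s <= 1 -> `|s - t| < e ->
         (s <= t -> P s -> P t) /\ (t <= s -> P t -> P s)) ->
  P 1.
Proof.
move=> P0 step; pose S := [set t | 0 <= t <= 1 /\ P t].
have S0 : S 0 by rewrite /S /= lexx ler01.
have supS : has_sup S by split; [exists 0|exists 1 => t [/andP[]]].
have c0 : 0 <= sup S by apply: ub_le_sup => //; exact: (proj2 supS).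
have c1 : sup S <= 1 by apply: ge_sup; [exists 0|move=> t [/andP[]]].
have [e e0 eP] : exists2 e, 0 < e & _ := step (sup S) ltac:(by rewrite c0 c1).
have [s [s01 Ps] es] := sup_adherent e0 supS.
have sc : s <= sup S by apply: ub_le_sup => //; exact: (proj2 supS).
have Pc : P (sup S).
  by apply: (proj1 (eP s s01 _)) => //; rewrite ler0_norm ?subr_le0//; lra.
have [c1'|c1'] := leP 1 (sup S); first by have -> : 1 = sup S by lra.
(* Otherwise the property would still hold slightly to the right of sup S. *)
pose d := Num.min (1 - sup S) (e / 2).
have d0 : 0 < d by rewrite lt_min subr_gt0 c1' divr_gt0.
have dc : d <= 1 - sup S by rewrite ge_min lexx.
have de : d <= e / 2 by rewrite ge_min lexx orbT.
have cd01 : 0 <= sup S + d <= 1 by apply/andP; split; lra.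
suff : S (sup S + d) by move=> /(ub_le_sup (proj2 supS)); lra.
split=> //; apply: (proj2 (eP _ cd01 _)) => //; last by lra.
by rewrite addrC addKr gtr0_norm//; lra.
Qed.

(** Points of a torus with lifts at distance less than [m]. *)
Definition torus_close L m (x y : torus L) :=
  exists z w, [/\ x = torus_pi L z, y = torus_pi L w & modulus (z - w) < m].

Lemma torus_close_sym L m (x y : torus L) : torus_close m x y -> torus_close m y x.
Proof. by move=> [z [w [xz yw zw]]]; exists w, z; rewrite modulusBC. Qed.

Lemma torus_close_lift L m (x y : torus L) z : x = torus_pi L z ->
  torus_close m x y -> exists w, y = torus_pi L w /\ modulus (w - z) < m.
Proof.
move=> -> [z' [w' [/torus_piP zz' -> zw]]]; exists (w' + (z - z')); split.
  by apply/torus_piP; rewrite opprD addrA subrr add0r; exact: latticeN.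
have -> : w' + (z - z') - z = - (z' - w') by ring.
by rewrite modulusN.
Qed.

(** [F] is a continuous map of the plane inducing [f] between the tori. *)
Definition lifts L L' (F : C -> C) (f : torus L -> torus L') :=
  continuous F /\ forall z, f (torus_pi L z) = torus_pi L' (F z).

(** Translating the argument by a vector of [L] changes [F] and [G] by the same
    amount. *)
Definition same_periods L (F G : C -> C) :=
  forall z l, lattice_set L l -> F (z + l) - F z = G (z + l) - G z.

(** A map close to a map that has a lift is lifted by choosing, in each fibre,
    the point close to the given lift. *)
Lemma lift_close L L' m (f g : torus L -> torus L') (F : C -> C) :
    lattice_gap L' m -> continuous g -> (forall x, torus_close (m / 4) (f x) (g x)) ->
  lifts F f -> exists G, lifts G g /\ same_periods L G F.
Proof.
move=> gap cg fg [cF Ff]; have m0 : 0 < m by case: gap.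
have /choice[G GP] : forall z, exists w,
    g (torus_pi L z) = torus_pi L' w /\ modulus (w - F z) < m / 4.
  by move=> z; apply: torus_close_lift (Ff z) (fg _).
exists G; split; first split.
- move=> z; apply/continuous_modulusP => e e0.
  pose e' := Num.min e (m / 4).
  have e'0 : 0 < e' by rewrite lt_min e0 divr_gt0.
  have e'e : e' <= e by rewrite ge_min lexx.
  have e'm : e' <= m / 4 by rewrite ge_min lexx orbT.
  have [d1 d10 d1P] := (continuous_modulusP F z).1 (cF z) _ e'0.
  have : nbhs (g (torus_pi L z)) [set y | torus_close e' (torus_pi L' (G z)) y].
    rewrite (GP z).1; apply/nbhs_torusP/nbhs_modulusP; exists e' => // w we.
    by exists (G z), w; rewrite modulusBC.
  move=> /cg /nbhs_torusP /nbhs_modulusP[d2 d20 d2P].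
  exists (Num.min d1 d2); first by rewrite lt_min d10.
  move=> w; rewrite lt_min => /andP[/d1P Fw /d2P].
  move=> /(torus_close_lift erefl)[v [gv vz]].
  suff -> : G w = v by lra.
  apply: (gap_inj gap); last by rewrite -gv (GP w).1.
  have := modulus_triangle (F w) (G w) v; have := modulus_triangle (F z) (F w) v.
  have := modulus_triangle (G z) (F z) v.
  have := (GP w).2; have := (GP z).2.
  rewrite (modulusBC (G z) v) (modulusBC (F z) (G z)).
  by lra.
- by move=> z; rewrite (GP z).1.
- move=> z l Ll.
  have Lc : lattice_set L' (F (z + l) - F z).
    apply/torus_piP; rewrite -!Ff; congr f; apply/torus_piP.
    by rewrite addrAC subrr add0r.
  suff -> : G (z + l) = G z + (F (z + l) - F z) by rewrite addrAC subrr add0r.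
  apply: (gap_inj gap); last first.
    rewrite -(GP (z + l)).1; have -> : torus_pi L (z + l) = torus_pi L z.
      by apply/torus_piP; rewrite addrAC subrr add0r.
    rewrite (GP z).1; apply/torus_piP.
    by rewrite opprD addrA subrr add0r; exact: latticeN.
  have -> : G (z + l) - (G z + (F (z + l) - F z)) =
      (G (z + l) - F (z + l)) - (G z - F z) by ring.
  have := modulusD (G (z + l) - F (z + l)) (- (G z - F z)).
  by rewrite modulusN; have := (GP (z + l)).2; have := (GP z).2; lra.
Qed.

(** A lift follows a homotopy backwards, without changing its periods. *)
Lemma homotopic_lift L L' m (f g : torus L -> torus L') (G : C -> C) :
    compact [set: torus L] -> lattice_gap L' m -> homotopic R f g -> lifts G g ->
  exists F, lifts F f /\ same_periods L F G.
Proof.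
move=> cptL gap [H [cH H01]] Gg; have m0 : 0 < m by case: gap.
have cHt t : 0 <= t <= 1 -> continuous (fun x => H (t, x)).
  move=> t01 x U HU.
  have /(subspace_continuousP _ _)/(_ (t, x)) := cH.
  move=> /(_ ltac:(by rewrite /= in_itv /= t01)) /(_ _ HU) [[A B]] /= [At Bx] AB.
  apply: filterS Bx => y By; apply: (AB (t, y)).
    by split => //=; exact: nbhs_singleton.
  by rewrite /= in_itv /= t01.
have Hnear t : 0 <= t <= 1 -> exists2 e, 0 < e & forall s, 0 <= s <= 1 ->
    `|s - t| < e -> forall x, torus_close (m / 4) (H (t, x)) (H (s, x)).
  move=> t01.
  have /compact_near_coveringP/(_ R (within `[0, 1] (nbhs t))
    (fun s x => torus_close (m / 4) (H (t, x)) (H (s, x)))) := cptL.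
  case.
    move=> x _; have [w Hw] := torus_pi_surj (H (t, x)).
    have : nbhs (H (t, x)) [set y | exists2 v, y = torus_pi L' v & modulus (v - w) < m / 8].
      rewrite Hw; apply/nbhs_torusP/nbhs_modulusP; exists (m / 8).
        by rewrite divr_gt0.
      by move=> v vw; exists v.
    have /(subspace_continuousP _ _)/(_ (t, x)) := cH.
    move=> /(_ ltac:(by rewrite /= in_itv /= t01)) cHtx /cHtx.
    move=> [[A B]] /= [At Bx] AB.
    exists (B, [set s | 0 <= s <= 1 /\ A s]).
      split=> //=; apply: filterS At => s As.
      by rewrite /= in_itv.
    move=> [y s] /= [By [s01 As]].
    have [v1 v1E v1w] : exists2 v, H (t, y) = torus_pi L' v & modulus (v - w) < m / 8.
      by apply: (AB (t, y)) => /=; [split=> //; exact: nbhs_singleton|rewrite in_itv/= t01].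
    have [v2 v2E v2w] : exists2 v, H (s, y) = torus_pi L' v & modulus (v - w) < m / 8.
      by apply: (AB (s, y)) => /=; [|rewrite in_itv/= s01].
    exists v1, v2; split=> //.
    by have := modulus_triangle w v1 v2; rewrite (modulusBC w v2); lra.
  move=> e /= e0 eP; exists e => // s s01 st x.
  have st' : ball t e s by rewrite /ball /= distrC.
  by apply: (eP s st' _ x I); rewrite /= in_itv.
(* The lift is known at time 1, hence the reversal of time. *)
pose P t := exists F, lifts F (fun x => H (1 - t, x)) /\ same_periods L F G.
suff : P 1.
  move=> [F [[cF Ff] per]]; exists F; split=> //; split=> // z.
  by rewrite -Ff subrr (H01 _).1.
apply: unit_interval_ind.
  exists G; split=> //; split; first exact: Gg.1.
  by move=> z; rewrite subr0 (H01 _).2 Gg.2.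
move=> t t01; have t01' : 0 <= 1 - t <= 1 by lra.
have [e e0 eP] := Hnear _ t01'; exists e => // s s01 st.
have s01' : 0 <= 1 - s <= 1 by lra.
have {}eP x : torus_close (m / 4) (H (1 - t, x)) (H (1 - s, x)).
  apply: eP => //; have -> : 1 - s - (1 - t) = - (s - t) by ring.
  by rewrite normrN.
split=> _ [F [Ff FG]].
- have [F' [F'f F'F]] := lift_close gap (cHt _ t01') (fun x => torus_close_sym (eP x)) Ff.
  by exists F'; split=> // z l Ll; rewrite F'F// FG.
- have [F' [F'f F'F]] := lift_close gap (cHt _ s01') eP Ff.
  by exists F'; split=> // z l Ll; rewrite F'F// FG.
Qed.

End Lifting.

(** * The square torus and the stretched torus *)

Section Rectangles.
Variable R : realType.
Local Notation C := (R[i]^o).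
Local Notation Re := complex.Re.
Local Notation Im := complex.Im.
Implicit Types (z w l : C) (a b r e t s : R).

Lemma zspan_axesP a b z :
  zspan (a +i* 0 : C) (0 +i* b) z <->
  exists m n : int, Re z = a * m%:~R /\ Im z = b * n%:~R.
Proof.
have zE m n : (a +i* 0 : C) *~ m + (0 +i* b : C) *~ n = (a * m%:~R) +i* (b * n%:~R).
  rewrite -mulrzr -[_ *~ n]mulrzr.
  rewrite -[m%:~R in LHS](rmorph_int (real_complex R)) -[n%:~R in LHS](rmorph_int (real_complex R)).
  by apply/eqP; rewrite eq_complex /=; apply/andP; split; apply/eqP; ring.
split=> [[m [n ->]]|[m [n [zm zn]]]]; exists m, n; first by rewrite zE.
by rewrite zE -zm -zn; case: z {zm zn}.
Qed.

Lemma square_latticeP z : lattice_set (square_lattice R) z <->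
  exists m n : int, Re z = m%:~R /\ Im z = n%:~R.
Proof.
apply: iff_trans (zspan_axesP 1 1 z) _.
by split=> -[m [n []]]; rewrite ?mul1r => zm zn; exists m, n; rewrite ?mul1r.
Qed.

Lemma stretched_area1 :
  exists w1 w2 : C, `|cross w1 w2| = 1 /\ zspan (2 +i* 0) (0 +i* 2^-1) = zspan w1 w2.
Proof.
exists (2 +i* 0), (0 +i* 2^-1); split=> //.
by rewrite /cross /= mul0r subr0 divff// normr1.
Qed.

(** The rectangular lattice with sides 2 and 1/2. *)
Definition stretched_lattice : lattice R := Lattice stretched_area1.

Lemma stretched_latticeP z : lattice_set stretched_lattice z <->
  exists m n : int, Re z = 2 * m%:~R /\ Im z = 2^-1 * n%:~R.
Proof. exact: zspan_axesP. Qed.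

Lemma int_small (m : int) : `|m%:~R : R| < 1 -> m = 0.
Proof.
by rewrite -intr_norm -[1]/(1%:~R) ltr_int; case: m => [[|n]|n].
Qed.

Lemma square_gap : lattice_gap (square_lattice R) 1.
Proof.
split=> // l /square_latticeP[m [n [lm ln]]] l1.
have := Re_modulus l; have := Im_modulus l; rewrite lm ln => nl ml.
have m0 : m = 0 by apply: int_small; lra.
have n0 : n = 0 by apply: int_small; lra.
by apply/eqP; rewrite eq_complex lm ln m0 n0 !eqxx.
Qed.

Lemma stretched_gap : lattice_gap stretched_lattice 2^-1.
Proof.
split=> // l /stretched_latticeP[m [n [lm ln]]] l1.
have := Re_modulus l; have := Im_modulus l; rewrite lm ln !normrM.
rewrite normfV normr_nat => nl ml.
have m0 : m = 0 by apply: int_small; have := normr_ge0 (m%:~R : R); lra.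
have n0 : n = 0 by apply: int_small; lra.
by apply/eqP; rewrite eq_complex lm ln m0 n0 !mulr0 !eqxx.
Qed.

(** The unit square projects onto the square torus. *)
Lemma square_torus_compact : compact [set: torus (square_lattice R)].
Proof.
pose K : set (R * R) := `[0, 1] `*` `[0, 1].
pose f (p : R * R) : torus (square_lattice R) := torus_pi _ (p.1 +i* p.2).
have cf : continuous f.
  move=> p; apply: (@continuous_comp _ _ _ (fun p : R * R => (p.1 +i* p.2 : C))); last first.
    exact: torus_pi_continuous.
  move=> P /nbhs_modulusP[e e0 eP].
  apply/nbhs_ballP; exists (e / 2) => /=; first by rewrite divr_gt0.
  move=> q [/= q1 q2]; apply: eP; apply: modulus_ReIm_lt.
    by rewrite /= distrC.
  by rewrite /= distrC.
have -> : [set: torus (square_lattice R)] = f @` K.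
  apply/seteqP; split=> // x _; have [z ->] := torus_pi_surj x.
  pose a := Re z; pose b := Im z.
  have a0 := Num.Theory.floor_le a; have a1 := Num.Theory.floorD1_gt a.
  have b0 := Num.Theory.floor_le b; have b1 := Num.Theory.floorD1_gt b.
  exists (a - (Num.floor a)%:~R, b - (Num.floor b)%:~R).
    by rewrite /K /= !in_itv/=; move: a1 b1; rewrite !intrD => a1 b1; split; apply/andP; split; lra.
  apply/torus_piP/square_latticeP; exists (- Num.floor a), (- Num.floor b).
  by rewrite cReB cImB /= !mulrNz -/a -/b; split; ring.
apply: continuous_compact; first exact: continuous_subspaceT.
by apply: compact_setX; exact: segment_compact.
Qed.

(** The affine map stretching the axes by [a] and [b], then translating by [c]. *)
Definition stretch a b (c z : C) : C := (a * Re z + Re c) +i* (b * Im z + Im c).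

Lemma stretchB a b c z w : stretch a b c z - stretch a b c w = stretch a b 0 (z - w).
Proof. by apply: complex_ext; rewrite ?cReB ?cImB /= ?cReB ?cImB; ring. Qed.

Lemma stretch_lipschitz a b c z w : 0 <= b <= a ->
  modulus (stretch a b c z - stretch a b c w) <= a * modulus (z - w).
Proof.
move=> /andP[b0 ba]; rewrite stretchB !modulusE /= !addr0.
have a0 : 0 <= a by exact: le_trans ba.
rewrite -[a in leRHS]ger0_norm// -sqrtr_sqr -sqrtrM ?sqr_ge0//.
apply: ler_wsqrtr; rewrite mulrDr !exprMn lerD2l ler_wpM2r ?sqr_ge0//.
by rewrite ler_pXn2r ?nnegrE.
Qed.

Lemma stretch_continuous a b c : continuous (stretch a b c).
Proof.
move=> z; apply/continuous_modulusP => e e0.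
pose k := `|a| + `|b| + 1; have k0 : 0 < k by rewrite ltr_wpDl ?addr_ge0.
exists (e / k); first by rewrite divr_gt0.
move=> w; rewrite ltr_pdivlMr// stretchB => we.
apply: le_lt_trans we; apply: le_trans (modulus_le _) _.
rewrite /= !addr0 !normrM.
have := Re_modulus (w - z); have := Im_modulus (w - z) => Iwz Rwz.
have := normr_ge0 a; have := normr_ge0 b; have := modulus_ge0 (w - z).
move=> ? ? ?.
have := ler_wpM2l (normr_ge0 a) Rwz; have := ler_wpM2l (normr_ge0 b) Iwz.
by rewrite /k !mulrDr mulr1; lra.
Qed.

Lemma stretchK a b c : a != 0 -> b != 0 ->
  cancel (stretch a b c) (stretch a^-1 b^-1 (- stretch a^-1 b^-1 0 c)).
Proof. by move=> a0 b0 z; apply: complex_ext; rewrite /=; field. Qed.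

Lemma stretchVK a b c : a != 0 -> b != 0 ->
  cancel (stretch a^-1 b^-1 (- stretch a^-1 b^-1 0 c)) (stretch a b c).
Proof. by move=> a0 b0 z; apply: complex_ext; rewrite /=; field. Qed.

Lemma descends_stretch c :
  descends (square_lattice R) stretched_lattice (stretch 2 2^-1 c).
Proof.
move=> z w /square_latticeP[m [n [zm zn]]]; rewrite stretchB.
by apply/stretched_latticeP; exists m, n; rewrite /= !addr0 zm zn.
Qed.

Lemma descends_unstretch c :
  descends stretched_lattice (square_lattice R) (stretch 2^-1 2 c).
Proof.
move=> z w /stretched_latticeP[m [n [zm zn]]]; rewrite stretchB.
apply/square_latticeP; exists m, n; rewrite /= !addr0 zm zn.
by split; field.
Qed.

(** A complex number within a right angle of the direction [s] has an argument
    that is an explicit continuous function of the number and of [s]. *)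
Lemma polar_atan z s : 0 < Re (z * (cos s -i* sin s)) ->
  z != 0 /\ z = (modulus z)%:C *
    expi (s + atan (Im (z * (cos s -i* sin s)) / Re (z * (cos s -i* sin s)))).
Proof.
set d := z * _ => d0.
have zd : z = d * expi s.
  rewrite /d -mulrA [X in z * X](_ : _ = 1) ?mulr1//.
  apply/eqP; rewrite eq_complex /=; apply/andP; split; apply/eqP; last by ring.
  by rewrite mulNr opprK -!expr2 cos2Dsin2.
have mz : modulus z = modulus d.
  by rewrite zd modulusM [modulus (expi s)]modulusE /= cos2Dsin2 sqrtr1 mulr1.
split; first by rewrite -modulus_eq0 mz modulus_eq0 eq_complex gt_eqF.
clearbody d; rewrite mz; set q := _ / _.
have mdE : modulus d = Re d * Num.sqrt (1 + q ^+ 2).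
  rewrite modulusE -[in RHS](ger0_norm (ltW d0)) -sqrtr_sqr -sqrtrM ?sqr_ge0//.
  by congr Num.sqrt; rewrite /q; field; exact: lt0r_neq0.
have q0 : Num.sqrt (1 + q ^+ 2) != 0.
  by rewrite sqrtr_eq0 -ltNge; apply: ltr_wpDr; rewrite ?sqr_ge0.
have sin_atan : sin (atan q) = q / Num.sqrt (1 + q ^+ 2).
  have c0 : cos (atan q) != 0 by rewrite cos_atan invr_eq0.
  by rewrite -[sin _](divfK c0) -/(tan (atan q)) atanK cos_atan.
have dq : Im d = Re d * q by rewrite /q mulrC divfK// gt_eqF.
rewrite [in LHS]zd mdE; apply: complex_ext.
  by rewrite [LHS](cReM d) dq /= cosD sinD cos_atan sin_atan; field.
by rewrite [LHS](cImM d) dq /= cosD sinD cos_atan sin_atan; field.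
Qed.

(** The image of a circle is an ellipse, which stays within a right angle of the
    rotating radius of the circle. *)
Lemma stretch_oriented (L L' : lattice R) a b c : 0 < a -> 0 < b ->
  descends L L' (stretch a b c) ->
  orientation_preserving (torus_map L' (stretch a b c) : torus L -> _).
Proof.
move=> a0 b0 dF z; exists (stretch a b c); split.
- by near=> w; rewrite torus_mapE.
- by near=> w; exact: stretch_continuous.
near=> r; have r0 : 0 < r by near: r; exact: nbhs_right_gt.
(* [g] runs along the ellipse, and [d] is [g] seen from the rotating radius. *)
pose g s : C := stretch a b 0 (r%:C * expi s).
have gE t : stretch a b c (z + r%:C * expi (2 * pi * t)) - stretch a b c z = g (2 * pi * t).
  by rewrite stretchB addrAC subrr add0r.
pose d s : C := g s * (cos s -i* sin s).
have dRe s : Re (d s) = r * (a * cos s ^+ 2 + b * sin s ^+ 2).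
  by rewrite /d /g /= !addr0; ring.
have dIm s : Im (d s) = r * ((b - a) * (cos s * sin s)).
  by rewrite /d /g /= !addr0; ring.
have d0 s : 0 < Re (d s).
  rewrite dRe mulr_gt0//.
  have := cos2Dsin2 s; have := sqr_ge0 (cos s); have := sqr_ge0 (sin s).
  set p := cos s ^+ 2; set q := sin s ^+ 2 => q0 p0 pq.
  have := mulr_ge0 (ltW a0) p0; have := mulr_ge0 (ltW b0) q0.
  have [a_le_b|/ltW b_le_a] := leP a b.
    have apq : a * p + a * q = a by rewrite -mulrDr pq mulr1.
    by have := ler_wpM2r q0 a_le_b; lra.
  have bpq : b * p + b * q = b by rewrite -mulrDr pq mulr1.
  by have := ler_wpM2r p0 b_le_a; lra.
pose theta s := s + atan (Im (d s) / Re (d s)).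
exists (fun t => theta (2 * pi * t)); split.
- apply: continuous_subspaceT => t.
  have cs : continuous (fun t : R => cos (2 * pi * t)).
    move=> x; apply: continuous_comp; last exact: continuous_cos.
    by apply: continuousM; [exact: cst_continuous|].
  have sn : continuous (fun t : R => sin (2 * pi * t)).
    move=> x; apply: continuous_comp; last exact: continuous_sin.
    by apply: continuousM; [exact: cst_continuous|].
  apply: continuousD; first by apply: continuousM; [exact: cst_continuous|].
  apply: continuous_comp; last exact: continuous_atan.
  rewrite (_ : (fun _ => _) = fun t => (r * ((b - a) * (cos (2 * pi * t) * sin (2 * pi * t)))) *
      (r * (a * (cos (2 * pi * t) * cos (2 * pi * t)) +
            b * (sin (2 * pi * t) * sin (2 * pi * t))))^-1); last first.
    by apply/funext => x; rewrite dIm dRe !expr2.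
  apply: cvgM.
    apply: cvgM; first exact: cvg_cst.
    by apply: cvgM; [exact: cvg_cst|apply: cvgM; [exact: cs|exact: sn]].
  apply: cvgV; first by have := d0 (2 * pi * t); rewrite dRe !expr2 => /lt0r_neq0.
  apply: cvgM; first exact: cvg_cst.
  by apply: cvgD; apply: cvgM; [exact: cvg_cst|by apply: cvgM; [exact: cs|exact: cs]|
    exact: cvg_cst|by apply: cvgM; [exact: sn|exact: sn]].
- by move=> t _; rewrite gE; exact: polar_atan (d0 _).
- have -> : theta (2 * pi * 1) = 2 * pi.
    by rewrite /theta dIm mulr1 mulr_natl sin2pi !mulr0 mul0r atan0 addr0.
  have -> : theta (2 * pi * 0) = 0.
    by rewrite /theta dIm mulr0 sin0 !mulr0 mul0r atan0 addr0.
  by rewrite subr0.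
Unshelve. all: by end_near. Qed.

End Rectangles.

(** * The extremal maps *)

Section Extremal.
Variable R : realType.
Local Notation C := (R[i]^o).
Local Notation Re := complex.Re.
Local Notation Im := complex.Im.
Local Notation square := (square_lattice R).
Local Notation stretched := (stretched_lattice R).
Implicit Types (z w l c : C) (r e t s k : R).

Lemma stretch_id z : stretch 1 1 0 z = z.
Proof. by apply: complex_ext; rewrite /= mul1r addr0. Qed.

Lemma descends_id : descends square square (stretch 1 1 0).
Proof. by move=> z w; rewrite !stretch_id. Qed.

Lemma torus_map_id (x : torus square) : torus_map square (stretch 1 1 0) x = x.
Proof.
have [z ->] := torus_pi_surj x.
by rewrite torus_mapE ?stretch_id//; exact: descends_id.
Qed.

Lemma stretch_unstretch z : stretch 2 2^-1 0 (stretch 2^-1 2 0 z) = z :> C.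
Proof. by apply: complex_ext; rewrite /= !addr0; field. Qed.

Lemma unstretch_stretch z : stretch 2^-1 2 0 (stretch 2 2^-1 0 z) = z :> C.
Proof. by apply: complex_ext; rewrite /= !addr0; field. Qed.

(** The square torus with the identity marking, written as an affine map. *)
Definition square_torus : marked_torus R.
Proof.
apply: (@MarkedTorus R square (torus_map square (stretch 1 1 0))
  (torus_map square (stretch 1 1 0))).
- by apply: torus_map_continuous; [exact: descends_id|exact: stretch_continuous].
- by apply: torus_map_continuous; [exact: descends_id|exact: stretch_continuous].
- by move=> x; rewrite !torus_map_id.
- by move=> x; rewrite !torus_map_id.
- by apply: stretch_oriented => //; exact: descends_id.
Defined.

(** The torus with sides 2 and 1/2, marked by the linear map onto the square
    torus that matches the sides. *)
Definition stretched_torus : marked_torus R.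
Proof.
apply: (@MarkedTorus R stretched (torus_map square (stretch 2^-1 2 0))
  (torus_map stretched (stretch 2 2^-1 0))).
- by apply: torus_map_continuous; [exact: descends_unstretch|exact: stretch_continuous].
- by apply: torus_map_continuous; [exact: descends_stretch|exact: stretch_continuous].
- move=> x; have [z ->] := torus_pi_surj x.
  rewrite torus_mapE; last exact: descends_unstretch.
  by rewrite torus_mapE ?stretch_unstretch//; exact: descends_stretch.
- move=> x; have [z ->] := torus_pi_surj x.
  rewrite torus_mapE; last exact: descends_stretch.
  by rewrite torus_mapE ?unstretch_stretch//; exact: descends_unstretch.
- by apply: stretch_oriented; rewrite ?invr_gt0//; exact: descends_unstretch.
Defined.

(** Stretching the square by 2 and 1/2, then translating by [c]. *)
Definition extremal_map c : torus square -> torus stretched :=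
  torus_map stretched (stretch 2 2^-1 c).

Lemma extremal_mapE c z :
  extremal_map c (torus_pi square z) = torus_pi stretched (stretch 2 2^-1 c z).
Proof. by rewrite /extremal_map torus_mapE//; exact: descends_stretch. Qed.

Lemma marking_change :
  marking_inv stretched_torus \o marking square_torus = extremal_map 0.
Proof. by apply/funext => x /=; rewrite torus_map_id. Qed.

Lemma extremal_map_homeomorphism c : homeomorphism (extremal_map c).
Proof.
have E : stretch 2^-1 2^-1^-1 (- stretch 2^-1 2^-1^-1 0 c) =
    stretch 2^-1 2 (- stretch 2^-1 2 0 c) by rewrite invrK.
apply: (@torus_map_homeomorphism _ _ _ _ (stretch 2^-1 2 (- stretch 2^-1 2 0 c))).
- exact: descends_stretch.
- exact: descends_unstretch.
- exact: stretch_continuous.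
- exact: stretch_continuous.
- by rewrite -E; apply: stretchK.
- by rewrite -E; apply: stretchVK.
Qed.

Lemma extremal_map_respects_markings c :
  @respects_markings R square_torus stretched_torus (extremal_map c).
Proof.
rewrite /respects_markings marking_change.
pose ct t : C := ((1 - t) * Re c) +i* ((1 - t) * Im c).
exists (fun p => extremal_map (ct p.1) p.2); split; last first.
  move=> x /=; split.
    by congr (extremal_map _ x); apply: complex_ext; rewrite /= subr0 mul1r.
  by congr (extremal_map _ x); apply: complex_ext; rewrite /= subrr mul0r.
apply: continuous_subspaceT; apply: torus_homotopy_continuous.
rewrite (_ : (fun _ => _) =
    torus_pi stretched \o (fun p => stretch 2 2^-1 (ct p.1) p.2)); last first.
  by apply/funext => p /=; rewrite extremal_mapE.
move=> [t z]; apply: continuous_comp; last exact: torus_pi_continuous.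
move=> P /nbhs_modulusP[e e0 eP].
have e2 : 0 < e / 2 by rewrite divr_gt0.
have [d d0 dP] := (continuous_modulusP _ _).1 (@stretch_continuous R 2 2^-1 (ct t) z) _ e2.
pose k := modulus c + 1; have k0 : 0 < k by rewrite ltr_wpDl ?modulus_ge0.
exists ([set s | `|s - t| < e / 2 / k], [set w | modulus (w - z) < d]).
  split=> /=; last by apply/nbhs_modulusP; exists d.
  apply/nbhs_ballP; exists (e / 2 / k); first by rewrite /= divr_gt0.
  by move=> s; rewrite /ball /= distrC.
move=> [s w] /= [st wz]; apply: eP.
apply: le_lt_trans (modulus_triangle (stretch 2 2^-1 (ct t) w) _ _) _.
have -> : stretch 2 2^-1 (ct s) w - stretch 2 2^-1 (ct t) w = (t - s)%:C * c.
  by apply: complex_ext; rewrite ?cReB ?cImB ?cReM ?cImM /=; ring.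
rewrite modulusM modulus_real distrC.
have : `|s - t| * k < e / 2 by rewrite -ltr_pdivlMr.
have := dP _ wz; have := modulus_ge0 c; rewrite /k mulrDr mulr1.
by have := normr_ge0 (s - t); lra.
Qed.

Lemma Lip_extremal_map_le c : (Lip (extremal_map c) <= 2%:E)%E.
Proof.
apply: ge_ereal_sup => _ [x [y [_ ->]]]; rewrite lee_fin.
have : flat_dist (extremal_map c x) (extremal_map c y) <= 2 * flat_dist x y.
  rewrite -ler_pdivrMl//; apply: lb_le_inf; first exact: lift_dists_neq0.
  move=> _ [z [w [<- <- ->]]]; rewrite !extremal_mapE ler_pdivrMl//.
  apply: le_trans (flat_dist_le _ _ _) _; apply: stretch_lipschitz.
  by rewrite invr_ge0 ler0n/=; lra.
have := flat_dist_ge0 x y; rewrite le_eqVlt => /predU1P[<-|d0].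
  by rewrite invr0 !mulr0 ler0n.
by rewrite ler_pdivrMr.
Qed.

(** A map respecting the markings has a lift that moves horizontal sides to
    horizontal segments of length 2, vertical ones to segments of length 1/2. *)
Lemma respects_markings_lift (phi : torus square -> torus stretched) :
    @respects_markings R square_torus stretched_torus phi ->
  exists F, [/\ lifts F phi,
    forall z, F (z + 1) = F z + (2 +i* 0) &
    forall z, F (z + (0 +i* 1)) = F z + (0 +i* 2^-1)].
Proof.
rewrite /respects_markings marking_change => hom.
have lift0 : lifts (stretch 2 2^-1 0) (extremal_map 0).
  by split; [exact: stretch_continuous|exact: extremal_mapE].
have [F [Fphi per]] := homotopic_lift (@square_torus_compact R) (stretched_gap R) hom lift0.
exists F; split=> // z.
  have /(per z) : lattice_set square 1.
    by apply/square_latticeP; exists 1, 0.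
  rewrite stretchB addrAC subrr add0r => /eqP; rewrite subr_eq => /eqP ->.
  by rewrite addrC; congr (_ + _); apply: complex_ext; rewrite /= addr0 ?mulr1 ?mulr0.
have /(per z) : lattice_set square (0 +i* 1).
  by apply/square_latticeP; exists 0, 1.
rewrite stretchB addrAC subrr add0r => /eqP; rewrite subr_eq => /eqP ->.
by rewrite addrC; congr (_ + _); apply: complex_ext; rewrite /= addr0 ?mulr1 ?mulr0.
Qed.

(** A lift moves the endpoints of a horizontal side of length 1 to points at
    distance 2. With a Lipschitz constant k < 2 it would multiply the lengths of
    short segments, which are flat distances, by at most k, hence also the
    length of the whole side. *)
Lemma Lip_ge2 (phi : torus square -> torus stretched) :
    @respects_markings R square_torus stretched_torus phi -> (2%:E <= Lip phi)%E.
Proof.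
move=> /respects_markings_lift[F [[cF Fphi] per _]].
rewrite leNgt; apply/negP => Lip2.
(* [k] is a real bound, nonnegative even if the supremum were over no pair. *)
pose k := Num.max 0 (fine (Lip phi)).
have k0 : 0 <= k by rewrite le_max lexx.
have Lipk : (Lip phi <= k%:E)%E.
  rewrite /k; case: (Lip phi) Lip2 => [r| |] // _; last by rewrite leNye.
  by rewrite lee_fin le_max lexx orbT.
have k2 : k < 2.
  rewrite /k gt_max ltr0n /=.
  by case: (Lip phi) Lip2 => [r| |] //=; rewrite lte_fin.
have phik x y : x <> y -> 0 < flat_dist x y ->
    flat_dist (phi x) (phi y) <= k * flat_dist x y.
  move=> xy d0; rewrite -ler_pdivrMr// -lee_fin; apply: le_trans Lipk.
  by apply: ereal_sup_ubound; exists x, y.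
pose g t := F (t%:C).
have gk t : exists2 e, 0 < e & forall s, `|s - t| < e -> modulus (g s - g t) <= k * `|s - t|.
  have [d d0 dP] := (continuous_modulusP F t%:C).1 (cF _) (2^-1 / 2) ltac:(by rewrite !divr_gt0).
  exists (Num.min d (1 / 2)); first by rewrite lt_min d0 divr_gt0.
  move=> s; rewrite lt_min => /andP[sd s1].
  have mst : modulus (s%:C - t%:C : C) = `|s - t| by rewrite -modulus_real rmorphB.
  have [->|st] := eqVneq s t; first by rewrite !subrr modulus0 normr0 mulr0.
  have gst : modulus (g s - g t) < 2^-1 / 2 by apply: dP; rewrite mst.
  rewrite -(flat_dist_close (stretched_gap R) gst) -!Fphi.
  have st0 : 0 < `|s - t| by rewrite normr_gt0 subr_eq0.
  have dst : flat_dist (torus_pi square s%:C) (torus_pi square t%:C) = `|s - t|.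
    by rewrite (flat_dist_close (@square_gap R)) ?mst.
  rewrite -dst; apply: phik; last by rewrite dst.
  move=> /(gap_inj (@square_gap R)); rewrite mst => /(_ ltac:(lra)) [] st'.
  by rewrite st' eqxx in st.
pose P t : Prop := Re (g t) - Re (g 0) <= k * t.
suff : P 1.
  rewrite /P /g -[X in F X](add0r (1%:C)) (per 0) cReD -[F 0%:C]/(F 0) /=; lra.
apply: unit_interval_ind; first by rewrite /P subrr mulr0.
move=> t _; have [e e0 eP] := gk t; exists e => // s _ /eP gst.
have := Re_modulus (g s - g t); rewrite cReB => Rst.
have {Rst} := le_trans Rst gst; rewrite ler_norml => /andP[st1 st2].
split=> [st|ts]; rewrite /P.
  by move: st1 st2; rewrite ler0_norm ?subr_le0//; lra.
by move: st1 st2; rewrite ger0_norm ?subr_ge0//; lra.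
Qed.

End Extremal.

(** * Cauchy's theorem on a square *)

Section Goursat.
Variable R : realType.
Implicit Types (x y h a b e : R).

Lemma continuous_antiderivative (f : R -> R) : continuous f ->
  exists F : R -> R, forall x, -1 < x < 2 -> is_derive x 1 F (f x).
Proof.
move=> cf; pose mu := @lebesgue_measure R.
exists (fun x => \int[mu]_(t in `[(-1), x]) f t)%R => x /andP[x1 x2].
have intf : mu.-integrable `[-1, 2] (EFin \o f).
  apply: continuous_compact_integrable; first exact: segment_compact.
  exact: continuous_subspaceT.
have [dF <-] := continuous_FTC1_closed x2 intf x1 (cf x).
by rewrite derive1E; exact: derivableP.
Qed.

Variables U V A B : R -> R -> R.
Hypothesis dA : forall x y, -1 < x < 2 -> is_derive x 1 (A ^~ y) (V x y).
Hypothesis dB : forall x y, -1 < y < 2 -> is_derive y 1 (B x) (U x y).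

(** The imaginary part of the integral of U + iV along the boundary of the
    square of side [h] with lower left corner (x, y), in terms of the primitives
    [A] of V along horizontal lines and [B] of U along vertical lines. *)
Definition boundary x y h :=
  (A (x + h) y - A x y) - (A (x + h) (y + h) - A x (y + h)) +
  (B (x + h) (y + h) - B (x + h) y) - (B x (y + h) - B x y).

(** The mean value theorem, applied to the difference of the primitives on
    opposite sides. *)
Lemma boundary_mean x y h : 0 < h ->
    0 <= x -> x + h <= 1 -> 0 <= y -> y + h <= 1 ->
  exists a b, [/\ x <= a <= x + h, y <= b <= y + h &
    boundary x y h = h * (V a y - V a (y + h) + U (x + h) b - U x b)].
Proof.
move=> h0 x0 xh y0 yh.
have derA t : x <= t <= x + h ->
    is_derive t 1 (fun t => A t y - A t (y + h)) (V t y - V t (y + h)).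
  move=> /andP[xt th].
  have dA1 : is_derive t 1 (A ^~ y) (V t y) by apply: dA; lra.
  have dA2 : is_derive t 1 (A ^~ (y + h)) (V t (y + h)) by apply: dA; lra.
  exact: is_deriveB.
have derB t : y <= t <= y + h ->
    is_derive t 1 (fun t => B (x + h) t - B x t) (U (x + h) t - U x t).
  move=> /andP[yt th].
  have dB1 : is_derive t 1 (B (x + h)) (U (x + h) t) by apply: dB; lra.
  have dB2 : is_derive t 1 (B x) (U x t) by apply: dB; lra.
  exact: is_deriveB.
have mvt (f df : R -> R) u : (forall t, u <= t <= u + h -> is_derive t 1 f (df t)) ->
    exists2 c, u <= c <= u + h & f (u + h) - f u = df c * h.
  move=> dfP; have [||c] := @MVT_segment R f df u (u + h) ltac:(by rewrite lerDl ltW).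
  - by move=> t; rewrite in_itv /= => /andP[ut tu]; apply: dfP; rewrite !ltW.
  - apply: derivable_within_continuous => t; rewrite in_itv /= => /dfP dft.
    exact: ex_derive.
  - by rewrite in_itv /= addrAC subrr add0r; exists c.
have [a xa Ea] := mvt _ _ _ derA; have [b yb Eb] := mvt _ _ _ derB.
exists a, b; split=> //; rewrite mulrC.
have -> : boundary x y h =
  (A (x + h) y - A (x + h) (y + h) - (A x y - A x (y + h))) +
  (B (x + h) (y + h) - B x (y + h) - (B (x + h) y - B x y)) by rewrite /boundary; ring.
by rewrite Ea Eb; ring.
Qed.

Lemma boundary_split x y h : boundary x y (h + h) =
  boundary x y h + boundary (x + h) y h +
  boundary x (y + h) h + boundary (x + h) (y + h) h.
Proof. by rewrite /boundary !addrA; ring. Qed.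

(** One of the four quarters of a square carries at least a quarter of the
    boundary integral. *)
Lemma boundary_quarter x y h c : c * 4 <= `|boundary x y (h + h)| ->
  exists x' y', [/\ x' = x \/ x' = x + h, y' = y \/ y' = y + h &
    c <= `|boundary x' y' h|].
Proof.
rewrite boundary_split => cJ.
have [?|J1] := leP c `|boundary x y h|.
  by exists x, y; split; [left|left|].
have [?|J2] := leP c `|boundary (x + h) y h|.
  by exists (x + h), y; split; [right|left|].
have [?|J3] := leP c `|boundary x (y + h) h|.
  by exists x, (y + h); split; [left|right|].
exists (x + h), (y + h); split; [by right|by right|].
have := ler_normD (boundary x y h + boundary (x + h) y h +
  boundary x (y + h) h) (boundary (x + h) (y + h) h).
have := ler_normD (boundary x y h + boundary (x + h) y h) (boundary x (y + h) h).
have := ler_normD (boundary x y h) (boundary (x + h) y h).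
by lra.
Qed.

(* U and V are differentiable everywhere, with dU/dx = dV/dy. *)
Hypothesis UV_diff : forall a b, exists p q r : R, forall e, 0 < e ->
  exists2 d, 0 < d & forall x y, `|x - a| < d -> `|y - b| < d ->
    `|U x y - U a b - (p * (x - a) + q * (y - b))| <= e * (`|x - a| + `|y - b|) /\
    `|V x y - V a b - (r * (x - a) + p * (y - b))| <= e * (`|x - a| + `|y - b|).

(** The linear parts of U and V do not contribute to the boundary integral, so
    that only the remainder, small compared with the side, is left. *)
Lemma boundary_small a b c : 0 < c -> exists2 d, 0 < d &
  forall x y h, 0 < h -> h < d -> 0 <= x -> x + h <= 1 -> 0 <= y -> y + h <= 1 ->
    x <= a <= x + h -> y <= b <= y + h -> `|boundary x y h| < c * h ^+ 2.
Proof.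
move=> c0; have [p [q [r UVP]]] := UV_diff a b.
(* The coordinates of the points of the square are at distance at most h from
   those of (a, b); hence each of the four errors below is at most
   2h c / 16 = h c / 8, and their sum at most h c / 2. *)
have c16 : 0 < c / 16 by rewrite divr_gt0.
have [d d0 dP] := UVP _ c16; exists d => // x y h h0 hd x0 xh y0 yh xa yb.
have [a' [b' [xa' yb' ->]]] := boundary_mean h0 x0 xh y0 yh.
have near u v : x <= u <= x + h -> y <= v <= y + h ->
    `|U u v - U a b - (p * (u - a) + q * (v - b))| <= c / 8 * h /\
    `|V u v - V a b - (r * (u - a) + p * (v - b))| <= c / 8 * h.
  move=> xu yv.
  have ua : `|u - a| <= h by rewrite ler_norml; apply/andP; split; lra.
  have vb : `|v - b| <= h by rewrite ler_norml; apply/andP; split; lra.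
  have [Uuv Vuv] := dP u v (le_lt_trans ua hd) (le_lt_trans vb hd).
  have le : c / 16 * (`|u - a| + `|v - b|) <= c / 8 * h.
    have -> : c / 8 * h = c / 16 * (h + h) by field.
    by rewrite ler_pM2l// lerD.
  by split; [exact: le_trans Uuv le|exact: le_trans Vuv le].
have xx : x <= x <= x + h by lra.
have xxh : x <= x + h <= x + h by lra.
have yy : y <= y <= y + h by lra.
have yyh : y <= y + h <= y + h by lra.
have [_ V1] := near a' y xa' yy; have [_ V2] := near a' (y + h) xa' yyh.
have [U1 _] := near (x + h) b' xxh yb'; have [U2 _] := near x b' xx yb'.
rewrite normrM gtr0_norm// expr2 mulrA [ltRHS]mulrC ltr_pM2l//.
apply: (@le_lt_trans _ _ (c / 8 * h * 4)); last by have := mulr_gt0 c0 h0; lra.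
move: V1 V2 U1 U2; rewrite !ler_norml => /andP[? ?] /andP[? ?] /andP[? ?] /andP[? ?].
by apply/andP; split; lra.
Qed.

(** Goursat's theorem: bisecting a square with nonzero boundary integral gives
    squares shrinking to a point and contradicting [boundary_small]. *)
Theorem boundary_unit_square : boundary 0 0 1 = 0.
Proof.
apply/eqP/negPn/negP => J0; pose c := `|boundary 0 0 1|.
have c0 : 0 < c by rewrite normr_gt0.
pose h n : R := 2^-1 ^+ n.
have h0 n : 0 < h n by rewrite exprn_gt0// invr_gt0.
have hS n : h n = h n.+1 + h n.+1 by rewrite /h exprS; field.
(* The squares of the bisection: s is the lower left corner, h n the side. *)
pose inv n (s : R * R) := [/\ 0 <= s.1, s.1 + h n <= 1, 0 <= s.2, s.2 + h n <= 1 &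
  c * h n ^+ 2 <= `|boundary s.1 s.2 (h n)|].
have /choice[next nextP] : forall ns : nat * (R * R), exists s',
    inv ns.1 ns.2 -> [/\ inv ns.1.+1 s',
      ns.2.1 <= s'.1 /\ s'.1 + h ns.1.+1 <= ns.2.1 + h ns.1 &
      ns.2.2 <= s'.2 /\ s'.2 + h ns.1.+1 <= ns.2.2 + h ns.1].
  move=> [n [x y]] /=; have [[/= x0 xh y0 yh cJ]|] := pselect (inv n (x, y)); last by exists 0.
  have /boundary_quarter : c * h n.+1 ^+ 2 * 4 <= `|boundary x y (h n.+1 + h n.+1)|.
    rewrite -hS; have -> : c * h n.+1 ^+ 2 * 4 = c * h n ^+ 2 by rewrite (hS n); ring.
    exact: cJ.
  move=> [x' [y' [x'E y'E cJ']]]; exists (x', y') => _.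
  have := h0 n.+1; have := hS n => hn hp.
  split=> /=; last 2 first.
  - by case: x'E => ->; split; lra.
  - by case: y'E => ->; split; lra.
  by split=> //=; [case: x'E|case: x'E|case: y'E|case: y'E] => ->; lra.
pose s := fix s n := if n is n'.+1 then next (n', s n') else (0, 0).
have sP n : inv n (s n).
  elim: n => [|n IHn]; last by have [] := nextP (n, s n) IHn.
  by rewrite /inv /= /h expr0 expr1n mulr1 add0r; split.
(* Both coordinates give nested intervals. *)
have nested (f : R * R -> R) :
    (forall n, f (s n) <= f (s n.+1) /\ f (s n.+1) + h n.+1 <= f (s n) + h n) ->
    exists a, forall n, f (s n) <= a <= f (s n) + h n.
  move=> fP; have lo n m : f (s n) <= f (s (m + n)%N).
    by elim: m => // m IHm; apply: le_trans IHm (fP _).1.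
  have hi n m : f (s (m + n)%N) + h (m + n)%N <= f (s n) + h n.
    by elim: m => // m IHm; apply: le_trans IHm; exact: (fP _).2.
  have lohi m n : f (s m) <= f (s n) + h n.
    apply: le_trans (lo m n) _; rewrite addnC; apply: le_trans (hi n m).
    by rewrite lerDl ltW.
  have ubd n : ubound (range (f \o s)) (f (s n) + h n) by move=> _ [m _ <-]; exact: lohi.
  exists (sup (range (f \o s))) => n; apply/andP; split.
    by apply: ub_le_sup; [exists (f (s 0%N) + h 0%N)|exists n].
  by apply: ge_sup; [exists (f (s 0%N)), 0%N|].
have [a aP] := nested fst ltac:(by move=> n; have [] := nextP (n, s n) (sP n)).
have [b bP] := nested snd ltac:(by move=> n; have [] := nextP (n, s n) (sP n)).
have [d d0 dP] := boundary_small a b c0.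
have [n hn] : exists n, h n < d.
  have : h @ \oo --> (0 : R) by apply: cvg_expr; rewrite gtr0_norm ?invr_gt0// invf_lt1// ltr1n.
  move=> /cvgr0Pnorm_lt/(_ _ d0) [N _ /(_ N (leqnn N))].
  by rewrite gtr0_norm//; exists N.
have [x0 xh y0 yh] := sP n; apply/negP; rewrite -ltNge.
exact: dP.
Qed.

End Goursat.

(** * The two tori are distinct in Teichmüller space *)

Section Conformal.
Variable R : realType.
Local Notation C := (R[i]^o).
Local Notation Re := complex.Re.
Local Notation Im := complex.Im.
Local Notation square := (square_lattice R).
Local Notation stretched := (stretched_lattice R).
Implicit Types (z w : C) (e r : R).

(** Complex differentiability, with the remainder bounded in modulus. *)
Lemma derivable_modulus (g : C -> C) z : derivable g z 1 ->
  exists a, forall e, 0 < e -> exists2 d, 0 < d & forall w, modulus (w - z) < d ->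
    modulus (g w - g z - a * (w - z)) <= e * modulus (w - z).
Proof.
rewrite /derivable => /cvg_ex[/= a ga]; exists a => e e0.
have : nbhs a [set w | modulus (w - a) < e] by apply/nbhs_modulusP; exists e.
move=> /ga; rewrite /= => near0.
have {near0} : nbhs (0 : C) [set h : C | h != 0 ->
    modulus (h^-1 * (g (h * 1 + z) - g z) - a) < e] by exact: near0.
move=> /nbhs_modulusP[d d0 dP]; exists d => // w wz.
have [->|w_z] := eqVneq w z; first by rewrite !subrr mulr0 subrr modulus0 mulr0.
have h0 : w - z != 0 by rewrite subr_eq0.
have := dP (w - z) ltac:(by rewrite subr0) h0; rewrite mulr1 subrK => /ltW ge.
have -> : g w - g z - a * (w - z) =
    ((w - z)^-1 * (g w - g z) - a) * (w - z) by rewrite mulrBl mulrAC mulVf// mul1r.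
by rewrite modulusM ler_wpM2r// modulus_ge0.
Qed.

(** A lift differs from a local expression by a locally constant element of
    the lattice, so that it is differentiable as well. *)
Lemma holomorphic_lift (L L' : lattice R) (m : R) (k : torus L -> torus L') (F : C -> C) :
    lattice_gap L' m -> holomorphic k -> lifts F k -> forall z,
  exists a, forall e, 0 < e -> exists2 d, 0 < d & forall w, modulus (w - z) < d ->
    modulus (F w - F z - a * (w - z)) <= e * modulus (w - z).
Proof.
move=> gap hk [cF Fk] z; have m0 : 0 < m by case: gap.
have [g [gk dg]] := hk z.
have [a ga] := derivable_modulus (nbhs_singleton dg); exists a => e e0.
have [d1 d10 d1P] := ga e e0.
have [d2 d20 d2P] : exists2 d, 0 < d & forall w, modulus (w - z) < d ->
    torus_pi L' (g w) = k (torus_pi L w) by exact/nbhs_modulusP.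
have m2 : 0 < m / 2 by rewrite divr_gt0.
have [d3 d30 d3P] := (continuous_modulusP F z).1 (cF z) _ m2.
have cg : {for z, continuous g}.
  by apply/differentiable_continuous/derivable1_diffP; exact: (nbhs_singleton dg).
have [d4 d40 d4P] := (continuous_modulusP g z).1 cg _ m2.
exists (Num.min (Num.min d1 d2) (Num.min d3 d4)).
  by rewrite !lt_min d10 d20 d30 d40.
move=> w; rewrite !lt_min => /andP[/andP[w1 w2] /andP[w3 w4]].
suff <- : g w - g z = F w - F z by exact: d1P.
apply: (gap_inj gap).
  have := modulusD (g w - g z) (- (F w - F z)); rewrite modulusN.
  by have := d3P _ w3; have := d4P _ w4; lra.
have gF v : modulus (v - z) < d2 -> lattice_set L' (g v - F v).
  by move=> /d2P; rewrite Fk => /torus_piP.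
apply/torus_piP; have -> : g w - g z - (F w - F z) = (g w - F w) - (g z - F z) by ring.
by apply: latticeB; [exact: gF|apply: gF; rewrite subrr modulus0].
Qed.

Lemma respects_markings_conformal
    (k : torus square -> torus stretched) :
    homotopic R (marking (stretched_torus R) \o k) (marking (square_torus R)) ->
  @respects_markings R (square_torus R) (stretched_torus R) k.
Proof.
move=> [H [cH H01]]; exists (marking_inv (stretched_torus R) \o H); split.
  apply/subspace_continuousP => p p01.
  apply: cvg_comp; first exact: ((subspace_continuousP _ _).1 cH p p01).
  exact: marking_inv_continuous.
by move=> x; rewrite /comp (H01 x).1 (H01 x).2 /comp markingK.
Qed.

(** The imaginary part of the integral of the lift of a conformal map along the
    boundary of the unit square is 0 by Cauchy's theorem, but also
    2 - 1/2 by comparison of opposite sides. *)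
Lemma not_teich_equiv : ~ teich_equiv (square_torus R) (stretched_torus R).
Proof.
move=> [k [[_ hk] /respects_markings_conformal /respects_markings_lift]].
move=> [F [Fk per1 peri]].
have dF := holomorphic_lift (stretched_gap R) hk Fk.
pose U x y := Re (F (x +i* y)); pose V x y := Im (F (x +i* y)).
have cF (f : R -> C) : (forall x y, modulus (f x - f y) = `|x - y|) -> continuous (F \o f).
  move=> fP x; apply: continuous_comp; last exact: Fk.1.
  move=> P /nbhs_modulusP[e e0 eP]; apply/nbhs_ballP; exists e => //= y.
  by rewrite /ball /= => xy; apply: eP; rewrite fP distrC.
have cRe (f : R -> C) : continuous f -> continuous (fun x => Re (f x)).
  move=> cf x P /nbhs_ballP[e /= e0 eP].
  have : nbhs (f x) [set w | modulus (w - f x) < e] by apply/nbhs_modulusP; exists e.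
  move=> /cf fx; have {fx} : \forall y \near x, modulus (f y - f x) < e by exact: fx.
  apply: filterS => y fy; apply: eP; rewrite /ball /= -cReB.
  by apply: le_lt_trans (Re_modulus _) _; rewrite modulusBC.
have cIm (f : R -> C) : continuous f -> continuous (fun x => Im (f x)).
  move=> cf x P /nbhs_ballP[e /= e0 eP].
  have : nbhs (f x) [set w | modulus (w - f x) < e] by apply/nbhs_modulusP; exists e.
  move=> /cf fx; have {fx} : \forall y \near x, modulus (f y - f x) < e by exact: fx.
  apply: filterS => y fy; apply: eP; rewrite /ball /= -cImB.
  by apply: le_lt_trans (Im_modulus _) _; rewrite modulusBC.
have /choice[A dA] : forall y : R, exists A : R -> R, forall x : R, -1 < x < 2 ->
    is_derive x 1 A (V x y).
  move=> y; apply: continuous_antiderivative.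
  apply: (cIm (F \o (fun x => x +i* y))); apply: cF => x x'.
  by rewrite modulusE cReB cImB /= subrr expr0n addr0 sqrtr_sqr.
have /choice[B dB] : forall x : R, exists B : R -> R, forall y : R, -1 < y < 2 ->
    is_derive y 1 B (U x y).
  move=> x; apply: continuous_antiderivative.
  apply: (cRe (F \o (fun y => x +i* y))); apply: cF => y y'.
  by rewrite modulusE cReB cImB /= subrr expr0n add0r sqrtr_sqr.
have dA' (x y : R) : -1 < x < 2 -> is_derive x 1 ((fun x y => A y x) ^~ y) (V x y) by exact: dA.
have UVd (a b : R) : exists p q r : R, forall e, 0 < e ->
  exists2 d, 0 < d & forall x y, `|x - a| < d -> `|y - b| < d ->
    `|U x y - U a b - (p * (x - a) + q * (y - b))| <= e * (`|x - a| + `|y - b|) /\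
    `|V x y - V a b - (r * (x - a) + p * (y - b))| <= e * (`|x - a| + `|y - b|).
  have [f fP] := dF (a +i* b); exists (Re f), (- Im f), (Im f) => e e0.
  have [d d0 dP] := fP e e0; exists (d / 2); first by rewrite divr_gt0.
  move=> x y xa yb; set w : C := x +i* y; set z : C := a +i* b.
  have wz : modulus (w - z) < d by apply: modulus_ReIm_lt; rewrite ?cReB ?cImB.
  have le : e * modulus (w - z) <= e * (`|x - a| + `|y - b|).
    by rewrite ler_pM2l//; apply: le_trans (modulus_le _) _; rewrite cReB cImB.
  have {le} := le_trans (dP w wz) le; set v := F w - F z - _ => ve.
  split; apply: le_trans ve.
    apply: le_trans (Re_modulus v); rewrite le_eqVlt; apply/orP; left; apply/eqP.
    by congr `|_|; rewrite /v !cReB cReM !cReB !cImB /= /U; ring.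
  apply: le_trans (Im_modulus v); rewrite le_eqVlt; apply/orP; left; apply/eqP.
  by congr `|_|; rewrite /v !cImB cImM !cReB !cImB /= /V; ring.
have J0 := boundary_unit_square dA' dB UVd.
have [|||||a [b [_ _]]] := boundary_mean dA' dB (x := 0) (y := 0) (h := 1); rewrite ?add0r//.
rewrite J0 mul1r.
have -> : V a 1 = V a 0 + 2^-1.
  rewrite /V (_ : a +i* 1 = (a +i* 0) + (0 +i* 1)) ?peri ?cImD//.
  by apply: complex_ext; rewrite ?cReD ?cImD /= ?addr0 ?add0r.
have -> : U 1 b = U 0 b + 2.
  rewrite /U (_ : 1 +i* b = (0 +i* b) + 1) ?per1 ?cReD//.
  by apply: complex_ext; rewrite ?cReD ?cImD /= ?addr0 ?add0r.
by lra.
Qed.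

End Conformal.

Theorem proposition3p8 (R : realType) :
  exists T T' : marked_torus R,
    ~ teich_equiv T T' /\
    infinite_set
      [set phi : torus (mt_lattice T) -> torus (mt_lattice T') |
        [/\ homeomorphism phi,
            respects_markings phi
          & Lip phi = extremal_Lip T T']].
Proof.
exists (square_torus R), (stretched_torus R); split; first exact: not_teich_equiv.
have extremal c : Lip (extremal_map c) = extremal_Lip (square_torus R) (stretched_torus R).
  apply/eqP; rewrite eq_le; apply/andP; split.
    apply: le_trans (Lip_extremal_map_le c) _.
    apply: le_ereal_inf_tmp => _ [phi [_ phim] <-]; exact: Lip_ge2.
  apply: ereal_inf_lbound; exists (extremal_map c) => //; split; last first.
    exact: extremal_map_respects_markings.
  split; first exact: extremal_map_homeomorphism.
  by apply: le_lt_trans (Lip_extremal_map_le c) _; rewrite ltry.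
(* The translations by 1 / (n + 1) are distinct modulo the period 2. *)
pose f n : torus (square_lattice R) -> torus (stretched_lattice R) :=
  extremal_map ((n.+1%:R : R)^-1 +i* 0).
have f_inj : injective f.
  move=> m n fmn; have := congr1 (@^~ (torus_pi (square_lattice R) 0)) fmn.
  rewrite /f !extremal_mapE => /torus_piP/stretched_latticeP[p [q [+ _]]].
  rewrite cReB /= mulr0 !add0r.
  have bnd j : 0 < (j.+1%:R : R)^-1 <= 1 by rewrite invr_gt0 ltr0n/= invf_le1 ?ltr0n// ler1n.
  have := bnd m; have := bnd n => /andP[n0 n1] /andP[m0 m1] mnp.
  have p0 : p = 0.
    apply: (@int_small R); rewrite ltr_norml; move: m0 m1 n0 n1 mnp.
    set u := _^-1; set v := _^-1; set r := p%:~R => m0 m1 n0 n1 mnp.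
    by apply/andP; split; lra.
  move: mnp; rewrite p0 mulr0 => /eqP; rewrite subr_eq0 => /eqP/invr_inj/eqP.
  by rewrite eqr_nat => /eqP[].
move=> /(finite_preimage (f := f)) fin; apply: infinite_nat.
apply: sub_finite_set (fin (in2W f_inj)) => n _; split; last exact: extremal.
  exact: extremal_map_homeomorphism.
exact: extremal_map_respects_markings.
Qed.
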